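(* Let $\Gamma$ be a straight-line planar drawing of a triconnected plane graph $G=(V,E)$, with vertex positions $\gamma_i\in\mathbb{R}^2$ ($i\in V$), whose outer face $F_0$ is drawn as a convex polygon. For every internal vertex $i$ and every neighbour $j\in N(i)$ let $z_{ij}>0$ be a real number such that $$\sum_{j\in N(i)} z_{ij}=1\quad\text{and}\quad \gamma_i=\sum_{j\in N(i)} z_{ij}\gamma_j$$ for each internal vertex $i$ (it is not assumed that $z_{ij}=z_{ji}$). Consider the homogeneous system of linear equations $$s_i z_{ij}-s_j z_{ji}=0\qquad\text{for each strictly internal edge }(i,j)\in E,$$ in the real unknowns $s_i$, one for each internal vertex $i$. This system has a nontrivial solution (that is, a solution other than $s=0$) if and only if for each strictly internal face $C=(v_0,v_1,\ldots,v_{k-1},v_k=v_0)$ of $G$ we have $$\prod_{i=0}^{k-1} z_{v_i,v_{i+1}}=\prod_{i=1}^{k} z_{v_i,v_{i-1}}.$$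
   Context: $N(i)$ denotes the set of neighbours of $i$ in $G$. $F_0$ denotes the outer face of the plane graph $G$. A vertex is external if it lies on $F_0$ and internal otherwise. An edge or a face is strictly internal if every vertex incident to it is internal. A face is identified with its boundary cycle, listed in cyclic order. *)

(* Defs.v *)
From mathcomp Require Import all_boot all_order all_algebra perm.
From mathcomp Require Import reals.

Set Implicit Arguments.
Unset Strict Implicit.
Unset Printing Implicit Defensive.

Import Order.TTheory GRing.Theory Num.Theory.
Local Open Scope ring_scope.

(* A plane graph is a connected simple graph with a combinatorial embedding of
   genus 0 and a distinguished outer face.  The embedding is a rotation system:
   [rot v] maps each neighbour of [v] to the next one counterclockwise around
   [v].  Every edge gives two darts (u, v) and (v, u). *)

Definition darts (V : finType) (e : rel V) : {pred V * V} :=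
  [pred d | e d.1 d.2].

(* Successor of the dart (u, v) on the boundary of the face to its right.  The
   faces are the orbits of this map; bounded faces are traversed clockwise, the
   outer face counterclockwise. *)
Definition face_next (V : finType) (r : V -> {perm V}) (d : V * V) : V * V :=
  (d.2, r d.2 d.1).

Record plane_graph (V : finType) := PlaneGraph {
  adj : rel V;
  adj_sym : symmetric adj;
  adj_irr : irreflexive adj;
  adj_connected : forall u v, connect adj u v;
  rot : V -> {perm V};
  (* [rot v] restricts to one single cycle on the neighbours of [v]; its values
     at non-neighbours are irrelevant. *)
  rot_cyclic : forall v u, adj v u -> porbit (rot v) u = [set w | adj v w];
  (* Euler's formula #V + #F = #E + 2 *)
  euler : (#|V| + fcard (face_next rot) (darts adj)
           = #|darts adj|./2 + 2)%N;
  (* any dart having the outer face F_0 on its right *)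
  outer : V * V;
  outer_dart : adj outer.1 outer.2
}.

Section PlaneGraphs.
Variables (V : finType) (G : plane_graph V).

Definition triconnected : Prop :=
  (3 < #|V|)%N /\
  forall S : {set V}, (#|S| < 3)%N -> forall u v, u \notin S -> v \notin S ->
    connect [rel x y | [&& adj G x y, x \notin S & y \notin S]] u v.

(* The boundary (v_0, v_1), (v_1, v_2), ..., (v_{k-1}, v_0) of the face to the
   right of [d]. *)
Definition face (d : V * V) : seq (V * V) := fingraph.orbit (face_next (rot G)) d.

Definition on_face (d : V * V) (v : V) : bool := v \in [seq x.1 | x <- face d].

Definition external (v : V) : bool := on_face (outer G) v.

Definition internal (v : V) : bool := ~~ external v.

Definition strictly_internal_edge (u v : V) : bool :=
  [&& adj G u v, internal u & internal v].

Definition strictly_internal_face (d : V * V) : Prop :=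
  adj G d.1 d.2 /\ forall v, on_face d v -> internal v.

End PlaneGraphs.

Section Drawings.
Variable R : realType.
Implicit Types a b c p : 'rV[R]_2.

Definition cross a b : R := a 0 0 * b 0 1 - a 0 1 * b 0 0.

(* For three distinct directions: a, b, c occur in this counterclockwise cyclic
   order iff at most one of the counterclockwise angles from a to b, from b to
   c and from c to a is at least pi. *)
Definition ccw_directions a b c : bool :=
  [|| (0 < cross a b) && (0 < cross b c),
      (0 < cross b c) && (0 < cross c a)
    | (0 < cross c a) && (0 < cross a b)].

Definition on_segment a b p : Prop :=
  exists t : R, [/\ 0 <= t, t <= 1 & p = (1 - t) *: a + t *: b].

Variables (V : finType) (G : plane_graph V) (gamma : V -> 'rV[R]_2).

Definition noncrossing : Prop :=
  [/\ injective gamma,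
      forall u x y, adj G x y -> on_segment (gamma x) (gamma y) (gamma u) ->
        u = x \/ u = y
    & forall u v x y, adj G u v -> adj G x y -> [set u; v] != [set x; y] ->
        forall p, on_segment (gamma u) (gamma v) p ->
          on_segment (gamma x) (gamma y) p ->
        exists2 w, w \in [set u; v] :&: [set x; y] & p = gamma w].

(* No neighbour w of v lies in the sector swept counterclockwise from u to
   [rot v u]. *)
Definition respects_rotation : Prop :=
  forall v u w, adj G v u -> adj G v w -> w != u -> w != rot G v u ->
    ccw_directions (gamma u - gamma v) (gamma (rot G v u) - gamma v)
                   (gamma w - gamma v).

Definition straight_line_planar_drawing : Prop :=
  noncrossing /\ respects_rotation.

(* Each edge of F_0 spans a supporting line of the drawing, which lies on the
   left of the edge: F_0 bounds a convex region and is the outer face of the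
   drawing.  A vertex of F_0 may have a straight angle. *)
Definition outer_face_convex : Prop :=
  forall d, d \in face G (outer G) ->
    forall w, 0 <= cross (gamma d.2 - gamma d.1) (gamma w - gamma d.1).

End Drawings.

(* Main.v *)
Require Import Defs.
From mathcomp Require Import all_boot all_order all_algebra perm.
From mathcomp Require Import reals sequences exp.
From mathcomp Require Import lra.

Set Implicit Arguments.
Unset Strict Implicit.
Unset Printing Implicit Defensive.

Import Order.TTheory GRing.Theory Num.Theory.
Local Open Scope ring_scope.

(* With [s = exp p], the system says that the 1-form [ln z_ij - ln z_ji] is the
   differential of [p], so the theorem follows once the subgraph of internal
   vertices is nonempty and connected and every 1-form on it with zero sum
   around each strictly internal face is exact.

   Exactness: by Euler's formula and a rank count, every circulation is the
   boundary of a function on faces.  If the circulation lives on internal edges,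
   that function is constant on the faces that touch the outer face, hence may
   be taken to vanish there.

   Connectedness: a closed curve through two vertices and two faces yields a
   closed 1-form supported on the edges leaving these vertices on one side of
   the curve; being exact, it contradicts triconnectedness unless one side is a
   single edge.  So an inner face meets the outer one in at most a vertex or an
   edge, and a function constant on internal edges, summed around the faces
   touching the outer face, extends to one constant on all edges. *)

Lemma connect_const (T : finType) (U : Type) (e : rel T) (h : T -> U) x y :
  (forall x y, e x y -> h x = h y) -> connect e x y -> h x = h y.
Proof.
move=> he /connectP[s]; elim: s x => [|z s IH] x /= => [_ -> //|].
by case/andP=> /he-> /IH.
Qed.

(** * Faces and rotations *)

Section PlaneGraph.
Variables (V : finType) (G : plane_graph V).
Implicit Types (u v w x y a b : V) (d e : V * V).

(* [rot] alone would be the rotation of sequences. *)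
Local Notation rot := Defs.rot.
Local Notation fn := (face_next (rot G)).

Lemma face_next_inj : injective fn.
Proof. by move=> [a u] [b v] [/= <- /perm_inj->]. Qed.

Lemma mem_face d e : (e \in face G d) = fconnect fn d e.
Proof. by rewrite -fconnect_orbit. Qed.

Lemma mem_face_next d e : (fn e \in face G d) = (e \in face G d).
Proof. by rewrite !mem_face -(same_fconnect1_r face_next_inj). Qed.

Lemma face_id d : d \in face G d.
Proof. by rewrite mem_face. Qed.

Lemma mem_face_sym d e : (e \in face G d) = (d \in face G e).
Proof. by rewrite !mem_face (fconnect_sym face_next_inj). Qed.

Lemma mem_face_eq d e c : d \in face G e -> (c \in face G d) = (c \in face G e).
Proof.
rewrite !mem_face => ed.
by rewrite (same_connect (fconnect_sym face_next_inj) ed).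
Qed.

Lemma adj_rot v a : adj G v a -> adj G v (rot G v a).
Proof.
move=> va; suff: rot G v a \in [set w | adj G v w] by rewrite inE.
by rewrite -(rot_cyclic va) -{1}[rot G v]expg1 mem_porbit.
Qed.

Lemma adj_face d e : e \in face G d -> adj G d.1 d.2 -> adj G e.1 e.2.
Proof.
rewrite mem_face => de dd.
suff : fclosed fn (darts (adj G)).
  by move=> /closed_connect/(_ _ _ de); rewrite !inE dd => <-.
apply: (intro_closed (fconnect_sym face_next_inj)) => x y /eqP <- /= .
rewrite !inE /= adj_sym; exact: adj_rot.
Qed.

Lemma rot_const (T : Type) (h : V -> T) v a b :
  (forall w, adj G v w -> h (rot G v w) = h w) ->
  adj G v a -> adj G v b -> h a = h b.
Proof.
move=> hr va vb.
have: b \in porbit (rot G v) a by rewrite (rot_cyclic va) inE.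
case/porbitP=> i ->; rewrite permX {b vb}.
suff [] : adj G v (iter i (rot G v) a) /\ h a = h (iter i (rot G v) a) by [].
elim: i => [|i [vi ->]] //=; split; first exact: adj_rot.
by rewrite hr.
Qed.

(** [I] is the arc of the rotation at [v] from just after [a] up to [b], so its indicator changes
    along the rotation only after [a] and after [b]. It is cut out by counting steps from [a]. *)
Lemma rot_interval v a b : adj G v a -> adj G v b -> a != b ->
  exists I : {set V}, [/\ a \notin I, b \in I &
    forall w, adj G v w ->
      (rot G v w \in I) = (w == a) || ((w \in I) && (w != b))].
Proof.
move=> va vb ab; pose r := rot G v; pose k := findex r a.
have conn w : adj G v w -> fconnect r a w.
  move=> vw; have : w \in porbit r a by rewrite (rot_cyclic va) inE.
  by case/porbitP=> i ->; rewrite permX fconnect_iter.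
have k0 w : adj G v w -> (k w == 0)%N = (w == a).
  move=> vw; apply/eqP/eqP=> [kw|->]; last exact: findex0.
  by rewrite -(iter_findex (conn w vw)) -/(k w) kw.
have kinj w : adj G v w -> (k w == k b) = (w == b).
  move=> vw; apply/eqP/eqP=> [kw|-> //].
  by rewrite -(iter_findex (conn w vw)) -/(k w) kw (iter_findex (conn b vb)).
exists [set w | (0 < k w <= k b)%N]; split.
- by rewrite inE /k findex0.
- by rewrite inE leqnn andbT lt0n k0 // eq_sym.
move=> w vw; rewrite !inE -(k0 w vw) -(kinj w vw).
have kw : (k w < order r a)%N by exact: findex_max (conn w vw).
have kb : (k b < order r a)%N by exact: findex_max (conn b vb).
have kb0 : (0 < k b)%N by rewrite lt0n k0 // eq_sym.
have ew : r w = iter (k w).+1 r a by rewrite iterS (iter_findex (conn w vw)).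
have [kw1|kw1] := ltnP (k w).+1 (order r a).
  rewrite -/r ew /k findex_iter // -/k /=.
  case: (posnP (k w)) => [-> //|kw0] /=.
  by rewrite -/(k w) ltn_neqAle andbC.
(* Here [w] is the last neighbour before the rotation returns to [a], which has index 0 and so lies
   outside the arc. *)
have {kw1} eo : (k w).+1 = order r a by apply/eqP; rewrite eqn_leq kw kw1.
rewrite -/r ew eo iter_order; last exact: perm_inj.
rewrite /k findex0 /= -/k; apply/esym/negbTE; rewrite negb_or.
have kbw: (k b <= k w)%N by rewrite -ltnS eo.
rewrite -lt0n (leq_trans kb0 kbw) /= negb_and negbK -ltnNge.
by rewrite orbC eq_sym -leq_eqVlt.
Qed.

Section Big.
Variables (T : Type) (idx : T) (op : Monoid.com_law idx).

Lemma big_face (h : V * V -> T) e :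
  \big[op/idx]_(d <- face G e) h d = \big[op/idx]_(d in face G e) h d.
Proof. by rewrite big_uniq ?orbit_uniq. Qed.

Lemma big_face_next (h : V * V -> T) e :
  \big[op/idx]_(d <- face G e) h (fn d) = \big[op/idx]_(d <- face G e) h d.
Proof.
rewrite !big_face [RHS](reindex_inj face_next_inj).
by apply: eq_bigl => d; rewrite mem_face_next.
Qed.

Lemma big_face_vertex (h : V -> T) e :
  \big[op/idx]_(d <- face G e) h d.2 = \big[op/idx]_(d <- face G e) h d.1.
Proof. exact: (big_face_next (fun d => h d.1)). Qed.

End Big.

(** The face of [(w, v)] also contains [(v, rot G v w)]; crossing that edge leads to the next face
    around [v]. *)
Lemma face_fun_const (U : Type) (f : V * V -> U) v a b :
  (forall d, adj G d.1 d.2 -> f (fn d) = f d) ->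
  (forall w, adj G v w -> f (v, w) = f (w, v)) ->
  adj G v a -> adj G v b -> f (a, v) = f (b, v).
Proof.
move=> fF fv; apply: (@rot_const _ (fun w => f (w, v))) => w vw.
have /fF <- : adj G (w, v).1 (w, v).2 by rewrite /= adj_sym.
by rewrite -fv // adj_rot.
Qed.

End PlaneGraph.

(** * Circulations are boundaries of functions on faces *)

Section Homology.
Variables (V : finType) (G : plane_graph V) (R : fieldType).
Implicit Types (u v w x y a b : V) (d e : V * V).

Local Notation rot := Defs.rot.
Local Notation fn := (face_next (rot G)).
Local Notation opp d := (d.2, d.1).

(** One orientation of each undirected edge, to index matrix columns. *)
Definition edges : {set V * V} :=
  [set d | adj G d.1 d.2 && (enum_rank d.1 < enum_rank d.2)%N].

Lemma big_darts (T : Type) (idx : T) (op : Monoid.com_law idx) (h : V * V -> T) :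
  \big[op/idx]_(d | adj G d.1 d.2) h d =
  \big[op/idx]_(d in edges) op (h d) (h (opp d)).
Proof.
rewrite big_split (bigID (fun d => (enum_rank d.1 < enum_rank d.2)%N)) /=.
congr (op _ _); first by apply: eq_bigl => d; rewrite inE.
rewrite (reindex_inj (inv_inj (f := fun d => opp d) _)) /=; last by case.
apply: eq_bigl => d; rewrite inE adj_sym -leqNgt leq_eqVlt.
case: eqP => //= e; have /enum_rank_inj ed : enum_rank d.1 = enum_rank d.2.
  exact: val_inj.
by rewrite ed adj_irr.
Qed.

Lemma card_darts : #|darts (adj G)| = #|edges|.*2.
Proof.
rewrite -!sum1_card -[LHS]/(\sum_(d | adj G d.1 d.2) 1)%N big_darts.
by rewrite big_split /= addnn.
Qed.

(** The dual graph is connected: all darts into a vertex share one value, and each edge passes it on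
    to the other end. *)
Lemma face_fun_connected (U : Type) (f : V * V -> U) d e :
  (forall d, adj G d.1 d.2 -> f (fn d) = f d) ->
  (forall d, adj G d.1 d.2 -> f d = f (opp d)) ->
  adj G d.1 d.2 -> adj G e.1 e.2 -> f d = f e.
Proof.
move=> fF fS; case: d e => [a u] [b v] /= au bv.
have cst w x y : adj G w x -> adj G w y -> f (x, w) = f (y, w).
  by apply: face_fun_const => // z wz; rewrite (fS (w, z)).
pose h w := if [pick x | adj G w x] is Some x then f (x, w) else f (a, u).
have hE w x : adj G w x -> f (x, w) = h w.
  rewrite /h => wx; case: pickP => [y wy|/(_ x)]; last by rewrite wx.
  exact: cst.
rewrite (hE u a) ?(hE v b) 1?adj_sym //.
apply: connect_const (adj_connected G u v) => x y xy.
by rewrite -(hE x y) // -(hE y x) 1?adj_sym // (fS (y, x)) //= adj_sym.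
Qed.

(** One canonical dart for each face. *)
Definition face_roots : {set V * V} :=
  [set d | (froot fn d == d) && adj G d.1 d.2].

Lemma card_edges : (#|V| + #|face_roots| = #|edges| + 2)%N.
Proof.
have := euler G; rewrite card_darts doubleK => <-; congr addn.
by apply: eq_card => d; rewrite !inE.
Qed.

(** Multiplying a row of vertex values by this matrix gives its differential; multiplying a row of
    edge values by the transpose gives its divergence. *)
Definition incidence : 'M[R]_(#|V|, #|edges|) :=
  \matrix_(i, j) (((enum_val j).2 == enum_val i)%:R
                  - ((enum_val j).1 == enum_val i)%:R).

Definition boundary : 'M[R]_(#|face_roots|, #|edges|) :=
  \matrix_(i, j) ((enum_val j \in face G (enum_val i))%:R
                  - (opp (enum_val j) \in face G (enum_val i))%:R).

Lemma sum_enum_delta (T : finType) (A : {pred T}) (h : T -> R) (x : T) :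
  x \in A ->
  \sum_(i < #|A|) h (enum_val i) * (x == enum_val i)%:R = h x.
Proof.
move=> Ax; rewrite -(big_enum_val (A := A) (fun t => h t * (x == t)%:R)) (bigD1 x) //=.
rewrite eqxx mulr1 big1 ?addr0 // => y /andP[_ yx].
by rewrite eq_sym (negbTE yx) mulr0.
Qed.

Lemma mul_incidence (p : V -> R) j :
  ((\row_i p (enum_val i)) *m incidence) 0 j
  = p (enum_val j).2 - p (enum_val j).1.
Proof.
rewrite mxE (eq_bigr (fun i : 'I_#|V| => 
    p (enum_val i) * ((enum_val j).2 == enum_val i)%:R
    - p (enum_val i) * ((enum_val j).1 == enum_val i)%:R)); last first.
  by move=> i _; rewrite !mxE mulrBr.
by rewrite sumrB !sum_enum_delta.
Qed.

Lemma froot_adj d : adj G d.1 d.2 -> froot fn d \in face_roots.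
Proof.
move=> ad; rewrite inE root_root ?eqxx //=; last first.
  exact/fconnect_sym/face_next_inj.
by apply: adj_face ad; rewrite mem_face connect_root.
Qed.

Lemma mem_face_root d e : froot fn e = e -> (d \in face G e) = (froot fn d == e).
Proof.
move=> ee; rewrite mem_face_sym mem_face -root_connect ?ee //.
exact/fconnect_sym/face_next_inj.
Qed.

Lemma mul_boundary (f : V * V -> R) j :
  ((\row_i f (enum_val i)) *m boundary) 0 j
  = f (froot fn (enum_val j)) - f (froot fn (opp (enum_val j))).
Proof.
have: enum_val j \in edges by exact: enum_valP.
rewrite inE => /andP[ad _].
rewrite mxE (eq_bigr (fun i : 'I_#|face_roots| => 
    f (enum_val i) * (froot fn (enum_val j) == enum_val i)%:R
    - f (enum_val i) * (froot fn (opp (enum_val j)) == enum_val i)%:R)); last first.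
  move=> i _; rewrite !mxE mulrBr.
  have: enum_val i \in face_roots by exact: enum_valP.
  by rewrite inE => /andP[/eqP ii _]; rewrite !mem_face_root.
by rewrite sumrB !sum_enum_delta // froot_adj //= adj_sym.
Qed.

(** The left kernel lies in the line of constant rows. *)
Lemma corank_le1 (m n : nat) (A : 'M[R]_(m, n)) :
  (forall u : 'rV_m, u *m A = 0 -> forall i j, u 0 i = u 0 j) ->
  (m <= \rank A + 1)%N.
Proof.
case: m A => // m A hA.
have: (kermx A <= (const_mx 1 : 'rV_m.+1))%MS.
  apply/rV_subP => u /sub_kermxP /hA uc.
  suff -> : u = u 0 0 *: const_mx 1 by apply: scalemx_sub.
  by apply/rowP => i; rewrite !mxE mulr1.
move/mxrankS; rewrite mxrank_ker => /leq_trans/(_ (rank_leq_row _)).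
by rewrite leq_subLR.
Qed.

(** A potential with zero differential is constant because [G] is connected. *)
Lemma rank_incidence : (#|V| <= \rank incidence + 1)%N.
Proof.
apply: corank_le1 => u u0 i k; pose p v := u 0 (enum_rank v).
have ep : u = \row_i p (enum_val i) by apply/rowP => l; rewrite !mxE /p enum_valK.
have {ep} pe d : d \in edges -> p d.2 = p d.1.
  move=> de; apply/eqP; rewrite -subr_eq0 -(enum_rankK_in de de) -mul_incidence.
  by rewrite -ep u0 mxE.
suff pc x y : p x = p y by move: (pc (enum_val i) (enum_val k)); rewrite /p !enum_valK.
apply: connect_const (adj_connected G x y) => {x y} x y xy.
have [lt|gt|/val_inj/enum_rank_inj-> //] := ltngtP (enum_rank x) (enum_rank y).
  by rewrite (pe (x, y)) // inE /= xy.
by rewrite (pe (y, x)) // inE /= adj_sym xy.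
Qed.

Lemma froot_next d : froot fn (fn d) = froot fn d.
Proof.
apply/esym/eqP; rewrite root_connect; first exact: fconnect1.
exact/fconnect_sym/face_next_inj.
Qed.

(** The same argument in the dual graph. *)
Lemma rank_boundary : (#|face_roots| <= \rank boundary + 1)%N.
Proof.
apply: corank_le1 => u u0 i k.
have ri : enum_val i \in face_roots by exact: enum_valP.
have rk : enum_val k \in face_roots by exact: enum_valP.
pose f d := u 0 (enum_rank_in ri d).
have ef : u = \row_i f (enum_val i).
  by apply/rowP => l; rewrite !mxE /f enum_valK_in.
pose g d := f (froot fn d).
have {ef} fe d : d \in edges -> g d = g (opp d).
  move=> de; apply/eqP; rewrite -subr_eq0 -(enum_rankK_in de de) -mul_boundary.
  by rewrite -ef u0 mxE.
have ge d : adj G d.1 d.2 -> g d = g (opp d).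
  case: d => x y /= xy.
  have [lt|gt|/val_inj/enum_rank_inj-> //] := ltngtP (enum_rank x) (enum_rank y).
    by rewrite (fe (x, y)) // inE /= xy.
  by rewrite (fe (y, x)) // inE /= adj_sym xy.
move: (ri) (rk); rewrite !inE => /andP[/eqP ei ai] /andP[/eqP ek ak].
have : g (enum_val i) = g (enum_val k).
  by apply: face_fun_connected ai ak => // d _; rewrite /g froot_next.
by rewrite /g ei ek /f !enum_valK_in.
Qed.

(** Discrete Stokes formula: when [A] is constant on faces, the left side pairs its boundary with a
    1-form, and the right side can be grouped by faces. *)
Lemma sum_edges (A : V * V -> R) (h : V * V -> R) :
  (forall d, h (opp d) = - h d) ->
  \sum_(d in edges) (A d - A (opp d)) * h d
  = \sum_(d | adj G d.1 d.2) A d * h d.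
Proof.
move=> ho; rewrite big_darts; apply: eq_bigr => d _ /=.
by rewrite ho mulrBl mulrN.
Qed.

(** The boundary of a face enters each vertex as often as it leaves it. *)
Lemma boundary_incidence : boundary *m incidence^T = 0.
Proof.
apply/matrixP => i k; rewrite !mxE.
have: enum_val i \in face_roots by exact: enum_valP.
rewrite inE => /andP[_ ai].
pose A d : R := (d \in face G (enum_val i))%:R.
pose h d : R := (d.2 == enum_val k)%:R - (d.1 == enum_val k)%:R.
rewrite (eq_bigr (fun j : 'I_#|edges| =>
  (A (enum_val j) - A (opp (enum_val j))) * h (enum_val j))); last first.
  by move=> j _; rewrite !mxE.
rewrite -(big_enum_val (A := mem edges) (fun d => (A d - A (opp d)) * h d)) /=.
rewrite sum_edges; last by move=> d; rewrite /h opprB.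
transitivity (\sum_(d <- face G (enum_val i)) h d).
  rewrite big_face big_mkcond [RHS]big_mkcond /=; apply: eq_bigr => d _.
  rewrite /A; case: ifP => ad; case: ifP => df; rewrite ?mul1r ?mul0r //.
  by have := adj_face df ai; rewrite ad.
rewrite sumrB; apply/eqP; rewrite subr_eq0; apply/eqP.
exact: (@big_face_vertex V G _ _ _ (fun v => (v == enum_val k)%:R)).
Qed.

(* Both spaces have dimension #E - #V + 1 = #F - 1, by Euler's formula. *)
Lemma kermx_incidence_sub : (kermx incidence^T <= boundary)%MS.
Proof.
have sub : (boundary <= kermx incidence^T)%MS.
  by apply/sub_kermxP; exact: boundary_incidence.
rewrite -(mxrank_leqif_sup sub) eqn_leq mxrankS //= mxrank_ker mxrank_tr.
have := card_edges; have := rank_incidence; have := rank_boundary.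
rewrite leq_subLR => hF hV eE.
rewrite -(leq_add2r 2) -eE (_ : 2 = 1 + 1)%N // addnACA leq_add //.
Qed.

Lemma circulation_boundary (g : V * V -> R) :
  (forall v, \sum_(d in edges) g d * ((d.2 == v)%:R - (d.1 == v)%:R) = 0) ->
  exists2 f : V * V -> R, forall d, f (fn d) = f d &
    forall d, d \in edges -> g d = f d - f (opp d).
Proof.
move=> g0; pose x := \row_(j < #|edges|) g (enum_val j).
have : (x <= boundary)%MS.
  apply: submx_trans kermx_incidence_sub; apply/sub_kermxP/rowP => i.
  rewrite !mxE -[RHS](g0 (enum_val i)) [RHS]big_enum_val.
  by apply: eq_bigr => j _; rewrite !mxE.
case/submxP => u xu.
have [d0 d0r] : exists d0, d0 \in face_roots.
  by exists (froot fn (outer G)); apply/froot_adj/outer_dart.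
pose h d := u 0 (enum_rank_in d0r d).
have eh : u = \row_i h (enum_val i).
  by apply/rowP => l; rewrite !mxE /h enum_valK_in.
exists (fun d => h (froot fn d)) => [d|d de]; first by rewrite froot_next.
rewrite -{2 3 4}(enum_rankK_in de de) -mul_boundary -eh -xu mxE.
by rewrite (enum_rankK_in de de).
Qed.

End Homology.

(** * Exactness of closed 1-forms *)

Section Exactness.
Variables (V : finType) (G : plane_graph V) (R : fieldType).
Implicit Types (u v w x y a b : V) (d e : V * V).

Local Notation rot := Defs.rot.
Local Notation fn := (face_next (rot G)).
Local Notation opp d := (d.2, d.1).

Lemma face_const (U : Type) (f : V * V -> U) d e :
  (forall d, f (fn d) = f d) -> e \in face G d -> f e = f d.
Proof.
move=> fF; rewrite mem_face => de; apply/esym; apply: connect_const de.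
by move=> x y /eqP <-.
Qed.

Lemma sum_darts_faces (h : V * V -> R) :
  \sum_(d | adj G d.1 d.2) h d
  = \sum_(e in face_roots G) \sum_(d <- face G e) h d.
Proof.
rewrite (partition_big (froot fn) (mem (face_roots G))) /=; last first.
  by move=> d; exact: froot_adj.
apply: eq_bigr => e; rewrite inE => /andP[/eqP ee ae]; rewrite big_face.
apply: eq_bigl => d; rewrite -mem_face_root //.
by apply: andb_idl => de; apply: adj_face de ae.
Qed.

(* A 1-form on the subgraph induced by [K] is exact iff it is orthogonal to all
   circulations of that subgraph.  A circulation is the boundary of a function
   on the faces of [G]; the last hypothesis, which says that the complement of
   the subgraph is connected, lets one subtract a constant so that only the
   faces inside [K] contribute. *)
Lemma closed_exact (K : pred V) (c : V -> V -> R) :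
  (forall x y, c y x = - c x y) ->
  (forall C, adj G C.1 C.2 -> (forall v, on_face G C v -> K v) ->
     \sum_(d <- face G C) c d.1 d.2 = 0) ->
  (forall f : V * V -> R, (forall d, f (fn d) = f d) ->
     (forall d, adj G d.1 d.2 -> ~~ (K d.1 && K d.2) -> f d = f (opp d)) ->
     exists k, forall d v, adj G d.1 d.2 -> on_face G d v -> ~~ K v -> f d = k) ->
  exists p : V -> R, forall x y, adj G x y -> K x -> K y -> c x y = p y - p x.
Proof.
move=> canti cclosed Kconn.
pose KE d := K d.1 && K d.2.
pose om d := if KE d then c d.1 d.2 else 0.
(* Differentials restricted to the edges inside [K]: exactness means that [om] lies in the row space
   of [BK]. *)
pose BK : 'M[R]_(#|V|, #|edges G|) := \matrix_(i, j)
  (if KE (enum_val j) then incidence G R i j else 0).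
pose x := \row_(j < #|edges G|) om (enum_val j).
have : (x <= BK)%MS.
  (* Membership is tested against the cokernel: each column of [Y], set to zero outside [K], is a
     circulation [g]. *)
  rewrite submxE; apply/eqP; move: (cokermx BK) (mulmx_coker BK) => Y BKY.
  apply/rowP => k; rewrite [RHS]mxE mxE; have ke := enum_valP k.
  pose g d := if KE d then Y (enum_rank_in ke d) k else 0.
  have [v|f fF fg] := @circulation_boundary V G R g.
    have := congr1 (fun A : 'M_(_, _) => A (enum_rank v) k) BKY.
    rewrite mxE [RHS]mxE; apply: etrans.
    rewrite big_enum_val; apply: eq_bigr => j _.
    rewrite !mxE /g enum_rankK enum_valK_in; case: (KE _); last by rewrite !mul0r.
    exact: mulrC.
  have [|k0 fk] := Kconn f fF.
    move=> d ad nK; apply/eqP; rewrite -subr_eq0; case: d ad nK => a b /= ab nK.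
    have [lt|gt|/val_inj/enum_rank_inj eab] := ltngtP (enum_rank a) (enum_rank b).
    - by rewrite -(fg (a, b)) ?inE ?ab //= /g /KE (negbTE nK).
    - rewrite -opprB oppr_eq0 -(fg (b, a)) ?inE /= 1?adj_sym ?ab //.
      by rewrite /g /KE andbC (negbTE nK).
    - by rewrite eab adj_irr in ab.
  (* Shifting [f] by [k0] keeps its boundary and kills it on every face that leaves [K]; on the
     other faces [c] has zero sum. *)
  transitivity (\sum_(d in edges G) ((f d - k0) - (f (opp d) - k0)) * om d).
    rewrite [RHS]big_enum_val; apply: eq_bigr => j _.
    rewrite opprB addrA addrNK -(fg _ (enum_valP j)) mxE /g enum_valK_in /om.
    by case: (KE _); rewrite ?mul0r ?mulr0 // mulrC.
  rewrite (sum_edges G (fun d => f d - k0)); last first.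
    by move=> d; rewrite /om /KE /= andbC; case: ifP; rewrite ?oppr0 // canti.
  rewrite sum_darts_faces; apply: big1 => e; rewrite inE => /andP[_ ae].
  have [/allP eK|/allPn[v ev nKv]] := boolP (all K [seq d.1 | d <- face G e]).
    rewrite big_seq (eq_bigr (fun d => (f e - k0) * c d.1 d.2)).
      by rewrite -big_seq -mulr_sumr cclosed ?mulr0.
    move=> d de; rewrite (face_const fF de) /om /KE !eK //.
      have : fn d \in face G e by rewrite mem_face_next.
      exact: (map_f (fun d => d.1)).
    exact: (map_f (fun d => d.1)).
  rewrite big_seq big1 // => d de.
  by rewrite (face_const fF de) (fk e v) // subrr mul0r.
case/submxP => u xu; exists (fun v => u 0 (enum_rank v)).
have main d : d \in edges G -> KE d ->
    c d.1 d.2 = u 0 (enum_rank d.2) - u 0 (enum_rank d.1).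
  move=> de Kd; pose j := enum_rank_in de d.
  have ej : enum_val j = d by rewrite enum_rankK_in.
  have := congr1 (fun A : 'rV_(_) => A 0 j) xu.
  rewrite mxE /om ej Kd => ->.
  pose p v := u 0 (enum_rank v); rewrite -[RHS]/(p d.2 - p d.1) -ej.
  rewrite -mul_incidence !mxE; apply: eq_bigr => i _.
  by rewrite !mxE ej Kd /p enum_valK.
move=> a b ab Ka Kb.
have [lt|gt|/val_inj/enum_rank_inj eab] := ltngtP (enum_rank a) (enum_rank b).
- by apply: (main (a, b)); rewrite ?inE /= ?ab // /KE /= Ka.
- rewrite canti (main (b, a)) ?opprB //; first by rewrite inE /= adj_sym ab.
  by rewrite /KE /= Ka Kb.
- by rewrite eab adj_irr in ab.
Qed.

Hypothesis tri : triconnected G.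

(** Being closed on all faces, [c] has a potential. It is constant off [S], since fewer than three
    vertices do not disconnect [G]. *)
Lemma closed_cut_const (S : {set V}) (c : V -> V -> R) u w1 w2 :
  (#|S| < 3)%N -> (forall x y, c y x = - c x y) ->
  (forall C, adj G C.1 C.2 -> \sum_(d <- face G C) c d.1 d.2 = 0) ->
  (forall x y, adj G x y -> x \notin S -> y \notin S -> c x y = 0) ->
  adj G u w1 -> adj G u w2 -> w1 \notin S -> w2 \notin S -> c u w1 = c u w2.
Proof.
move=> S3 canti cclosed cS uw1 uw2 w1S w2S.
have [] := @closed_exact predT c canti.
- by move=> C aC _; exact: cclosed.
- by move=> f _ _; exists 0.
move=> p cp; rewrite !cp //; congr (_ - _).
apply: connect_const (tri.2 S S3 w1 w2 w1S w2S) => x y /and3P[xy xS yS].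
by apply/esym/eqP; rewrite -subr_eq0 -cp // cS.
Qed.

End Exactness.

(** * Closed curves through one or two vertices *)

Section Triconnected.
Variables (V : finType) (G : plane_graph V) (tri : triconnected G).
Implicit Types (u v w x y a b : V) (d e : V * V).

Local Notation rot := Defs.rot.
Local Notation fn := (face_next (rot G)).

(** When [I] is an arc of the rotation at [v], this is the crossing form of a dual path that goes
    round [v] through the edges to [I]. *)
Definition star v (I : {set V}) x y : rat :=
  ((x == v) && (y \in I))%:R - ((y == v) && (x \in I))%:R.

Lemma sum_face_delta (e C : V * V) (k : rat) :
  \sum_(d <- face G C) (if d == e then k else 0) = if e \in face G C then k else 0.
Proof.
rewrite big_face -big_mkcondr; case: ifP => eC; last first.
  by rewrite big1 // => d /andP[dC /eqP de]; rewrite -de dC in eC.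
by rewrite (big_pred1 e) // => d /=; case: eqP => [->|_]; rewrite ?eC ?andbF.
Qed.

(** Each passage [(x, v)], [(v, rot G v x)] of the face through [v] contributes the change of the
    indicator of [I] from [x] to its successor, which is nonzero only at [a] and [b]. *)
Lemma sum_star v a b (I : {set V}) C :
  a \notin I -> b \in I ->
  (forall w, adj G v w ->
     (rot G v w \in I) = (w == a) || ((w \in I) && (w != b))) ->
  adj G C.1 C.2 ->
  \sum_(d <- face G C) star v I d.1 d.2
  = ((a, v) \in face G C)%:R - ((b, v) \in face G C)%:R.
Proof.
move=> aI bI hI aC; rewrite /star sumrB.
rewrite -(@big_face_next V G _ _ _ (fun d => ((d.1 == v) && (d.2 \in I))%:R)) -sumrB /=.
pose D x d : rat := if d == (x, v) then 1 else 0.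
transitivity (\sum_(d <- face G C) (D a d - D b d)).
  rewrite big_seq [RHS]big_seq; apply: eq_bigr => -[x y] /= dC.
  rewrite /D !xpair_eqE; case: eqP => [yv|_] /=; last by rewrite !andbF subrr.
  have {dC} vx : adj G v x by rewrite adj_sym -yv; apply: (adj_face dC aC).
  rewrite yv hI // !andbT.
  case: (x =P a) => [->|xa] /=.
    by rewrite (negbTE aI) eq_sym (negbTE (memPn aI b bI)).
  by case: (x =P b) => [->|xb] /=; rewrite ?bI ?andbT ?andbF ?sub0r ?subrr.
rewrite sumrB !sum_face_delta.
by do 2!case: (_ \in _).
Qed.

Lemma star_anti v I x y : star v I y x = - star v I x y.
Proof. by rewrite /star opprB. Qed.

Lemma star_cut v (I S : {set V}) x y :
  v \in S -> x \notin S -> y \notin S -> star v I x y = 0.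
Proof.
move=> vS xS yS; rewrite /star ![_ == v]eq_sym.
by rewrite (negbTE (memPn xS v vS)) (negbTE (memPn yS v vS)) subrr.
Qed.

Lemma starE v I w : w != v -> star v I v w = (w \in I)%:R.
Proof. by move=> wv; rewrite /star eqxx (negbTE wv) subr0. Qed.

Lemma adj_neq v w : adj G v w -> w != v.
Proof. by case: eqP => // ->; rewrite adj_irr. Qed.

(** If [a] and [b] differed, the dual path round [v] would begin and end in the same face. Its form
    would be closed, hence constant on the edges at [v], yet it is 0 at [a] and 1 at [b]. *)
Lemma face_vertex_once v a b :
  adj G v a -> adj G v b -> (b, v) \in face G (a, v) -> a = b.
Proof.
move=> va vb bF; apply/eqP/negP=> /negP ab.
have [I [aI bI hI]] := rot_interval va vb ab.
suff: star v I v a = star v I v b.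
  rewrite !starE ?adj_neq // (negbTE aI) bI => /eqP.
  by rewrite eq_sym oner_eq0.
apply: (closed_cut_const tri (S := [set v])); rewrite ?cards1 ?inE ?adj_neq //.
- by move=> x y; rewrite star_anti.
- move=> C aC; rewrite (sum_star aI bI hI aC).
  by rewrite !(mem_face_sym _ C) (mem_face_eq _ bF) subrr.
- by move=> x y _ xv yv; apply: star_cut xv yv; rewrite inE.
Qed.

(** A closed curve runs through [u], one face, [v] and the other face. The forms of the dual paths
    round [u] and [v] have opposite sums on these faces, so their sum [c] is closed. Removing [u]
    and [v] leaves a connected graph, so one side of the curve at [u] holds no neighbour but [v]:
    the edge [uv] separates the two faces. *)
Lemma common_vertices_two_faces u v a1 a2 b1 b2 : u != v ->
  adj G u a1 -> adj G u a2 -> adj G v b1 -> adj G v b2 ->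
  (b2, v) \in face G (a1, u) -> (b1, v) \in face G (a2, u) ->
  (a2, u) \notin face G (a1, u) ->
  (a1 = v /\ rot G u a2 = v) \/ (a2 = v /\ rot G u a1 = v).
Proof.
move=> uv ua1 ua2 vb1 vb2 f1 f2 f12.
have a12 : a1 != a2 by apply: contra f12 => /eqP->; exact: face_id.
have b12 : b1 != b2.
  apply: contra f12 => /eqP eb.
  by rewrite mem_face_sym -(mem_face_eq _ f2) eb (mem_face_eq _ f1) face_id.
have [I [a1I a2I hI]] := rot_interval ua1 ua2 a12.
have [J [b1J b2J hJ]] := rot_interval vb1 vb2 b12.
pose c x y := star u I x y + star v J x y.
have cE w1 w2 : adj G u w1 -> adj G u w2 -> w1 != v -> w2 != v ->
    (w1 \in I) = (w2 \in I).
  move=> uw1 uw2 w1v w2v.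
  have cu w : adj G u w -> w != v -> c u w = (w \in I)%:R.
    move=> uw wv; rewrite /c starE ?adj_neq // /star (negbTE uv) (negbTE wv).
    by rewrite subrr addr0.
  have : (w1 \in I)%:R = (w2 \in I)%:R :> rat.
    rewrite -!cu //; apply: (closed_cut_const tri (S := [set u; v])) => //.
    - by rewrite cards2 uv.
    - by move=> x y; rewrite /c !(star_anti _ _ x) -opprD.
    - move=> C aC; rewrite big_split /= (sum_star a1I a2I hI aC).
      rewrite (sum_star b1J b2J hJ aC) !(mem_face_sym _ C).
      by rewrite (mem_face_eq _ f1) (mem_face_eq _ f2) addrC subrKA subrr.
    - move=> x y _ xS yS.
      by rewrite /c !(star_cut _ _ xS yS) ?inE ?eqxx ?orbT ?addr0.
    - by rewrite !inE negb_or w1v adj_neq.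
    - by rewrite !inE negb_or w2v adj_neq.
  by do 2!case: (_ \in I) => //= /eqP; rewrite ?oner_eq0 // eq_sym oner_eq0.
(* By [cE], the neighbours of [u] other than [v] are all in [I] or all outside. As [a1] is outside
   and [a2] inside, either the outside or the inside is [v] alone. *)
have [a1v|a1v] := eqVneq a1 v.
  left; split=> //; apply/eqP; apply: contraT => rv.
  have := cE _ _ ua2 (adj_rot ua2).
  by rewrite rv -{1}a1v eq_sym a12 a2I hI // eq_sym (negbTE a12) eqxx a2I => /(_ isT isT).
right; split; apply/eqP; apply: contraT => nv.
  by have := cE _ _ ua1 ua2 a1v nv; rewrite a2I (negbTE a1I).
by have := cE _ _ ua1 (adj_rot ua1) a1v nv; rewrite hI // eqxx (negbTE a1I).
Qed.

End Triconnected.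

(** * The outer face is an induced cycle *)

Section OuterFace.
Variables (V : finType) (G : plane_graph V) (tri : triconnected G).
Implicit Types (u v w x y a b : V) (d e : V * V).

Local Notation rot := Defs.rot.
Local Notation fn := (face_next (rot G)).

(** Otherwise [w] and [rot G v w] are the only neighbours of [v], and deleting them cuts [v] off
    from a remaining vertex. *)
Lemma degree_ge3 v w : adj G v w -> rot G v w != w /\ rot G v (rot G v w) != w.
Proof.
move=> vw; suff r2 : rot G v (rot G v w) != w.
  by split=> //; apply: contra r2 => /eqP rw; rewrite !rw.
apply/negP => /eqP r2; pose S := [set w; rot G v w].
have NS x : adj G v x -> x \in S.
  move=> vx; suff <- : (w \in S) = (x \in S) by rewrite !inE eqxx.
  apply: (rot_const (h := fun y => y \in S) _ vw vx) => y _.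
  by rewrite !inE (inj_eq perm_inj) -{1}r2 (inj_eq perm_inj) orbC.
have S2 : (#|S| < 3)%N by rewrite cards2; case: (_ != _).
have vS : v \notin S.
  by apply/negP; rewrite !inE => /orP[] /eqP e; move: (adj_rot vw) (vw); rewrite -e adj_irr.
have [x xvS] : exists x, x \notin v |: S.
  apply/existsP; rewrite -negb_forall; apply/negP => /forallP all.
  have : (#|V| <= #|v |: S|)%N by rewrite subset_leq_card //; apply/subsetP.
  by rewrite leqNgt (leq_ltn_trans _ tri.1) // cardsU1 vS.
move: xvS; rewrite in_setU1 negb_or => /andP[xv xS].
suff : (v == v) = (x == v) by rewrite eqxx (negbTE xv).
apply: (connect_const (h := fun y => y == v) _ (tri.2 S S2 v x vS xS)).
move=> y z /and3P[yz yS zS]; apply/eqP/eqP => e.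
  by rewrite e in yz; rewrite NS in zS.
by rewrite e adj_sym in yz; rewrite NS in yS.
Qed.

Lemma on_faceP e v : adj G e.1 e.2 ->
  reflect (exists2 a, adj G v a & (a, v) \in face G e) (on_face G e v).
Proof.
move=> ae; apply: (iffP mapP) => [[d de ->]|[a va aF]]; last first.
  by exists (fn (a, v)); rewrite ?mem_face_next.
have := f_invF (@face_next_inj V G) d.
case: (invF _ _) => a b dE; move: de; rewrite -dE mem_face_next /= => abF.
by exists a => //; rewrite adj_sym; apply: (adj_face abF ae).
Qed.

Local Notation F0 := (face G (outer G)).

Lemma externalP v : reflect (exists2 a, adj G v a & (a, v) \in F0) (external G v).
Proof. exact/on_faceP/outer_dart. Qed.

Lemma outer_adj a b : (a, b) \in F0 -> adj G a b.
Proof. by move=> abF; apply: (adj_face abF); exact: outer_dart. Qed.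

Lemma outer_external a b : (a, b) \in F0 -> external G a /\ external G b.
Proof.
move=> abF; split; last by apply/externalP; exists a => //; rewrite adj_sym outer_adj.
exact: (map_f (fun d => d.1) abF).
Qed.

Lemma outer_next a v : (a, v) \in F0 -> (v, rot G v a) \in F0.
Proof. by move=> avF; rewrite -(mem_face_next G _ (a, v)) in avF. Qed.

Lemma face_prev_unique e v a b : adj G e.1 e.2 ->
  (a, v) \in face G e -> (b, v) \in face G e -> a = b.
Proof.
move=> ae aF bF; apply: (face_vertex_once tri (v := v)).
- by rewrite adj_sym; apply: (adj_face aF).
- by rewrite adj_sym; apply: (adj_face bF).
- by rewrite (mem_face_eq _ aF).
Qed.

Lemma rot_prev v b : adj G v b -> exists2 a, adj G v a & rot G v a = b.
Proof.
move=> vb; exists ((rot G v)^-1 b)%g; last by rewrite permKV.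
suff : ((rot G v)^-1 b)%g \in [set w | adj G v w] by rewrite inE.
rewrite -(rot_cyclic vb) -porbitV.
by have := mem_porbit (rot G v)^-1 1 b; rewrite expg1.
Qed.

Lemma face_next_unique e v b c : adj G e.1 e.2 ->
  (v, b) \in face G e -> (v, c) \in face G e -> b = c.
Proof.
move=> ae bF cF; have [a va /= ab] := rot_prev (adj_face bF ae).
have [a' va' /= ac] := rot_prev (adj_face cF ae).
rewrite -ab -ac; congr (rot G v _); apply: (face_prev_unique (v := v) ae).
  by rewrite -mem_face_next /face_next /= ab.
by rewrite -mem_face_next /face_next /= ac.
Qed.

(** If [(u, v)] is not on F_0, its face and F_0 are distinct and share [u] and [v], so the edge
    borders both. *)
Lemma outer_face_induced u v :
  external G u -> external G v -> adj G u v -> (u, v) \in F0 \/ (v, u) \in F0.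
Proof.
move=> /externalP[a2 ua2 a2F] /externalP[b1 vb1 b1F] uv.
have [a1 ua1 a1v] := rot_prev uv.
have e : fn (a1, u) = (u, v) by rewrite /face_next /= a1v.
have [uvF|uvF] := boolP ((u, v) \in F0); [by left | right].
have [] := common_vertices_two_faces (v := v) (b1 := b1) (b2 := u) tri _ ua1 ua2.
- by rewrite eq_sym (adj_neq uv).
- by [].
- by rewrite adj_sym.
- by rewrite -e mem_face_next face_id.
- by rewrite (mem_face_eq _ a2F).
- apply: contra uvF => a2f; rewrite -e mem_face_next.
  by rewrite mem_face_sym (mem_face_eq _ a2F) in a2f.
- by case=> _ a2v; rewrite -a2v outer_next in uvF.
- by case=> <-.
Qed.

Lemma external_neighbour v a b x : (a, v) \in F0 -> (v, b) \in F0 ->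
  adj G v x -> external G x -> x = a \/ x = b.
Proof.
move=> aF bF vx xe; have [ve _] := outer_external bF.
case: (outer_face_induced ve xe vx) => F; [right|left].
  exact: (face_next_unique (outer_dart G) F bF).
exact: (face_prev_unique (outer_dart G) F aF).
Qed.

(** The only external neighbours of [v] are its predecessor and successor on F_0, and degree at
    least three excludes both. *)
Lemma rot_outer_internal v b : (v, b) \in F0 -> internal G (rot G v b).
Proof.
move=> bF; apply/negP => re.
have /externalP[a va aF] := (outer_external bF).1.
have vb := outer_adj bF.
have ab : rot G v a = b by apply: (face_next_unique (outer_dart G) _ bF); apply: outer_next.
have [n1 n2] := degree_ge3 va.
have [] := external_neighbour aF bF (adj_rot vb) re.
  by rewrite -ab => e; rewrite e eqxx in n2.
by move=> e; have [] := degree_ge3 vb; rewrite e eqxx.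
Qed.

Lemma rot_outer_internal' v a w :
  (a, v) \in F0 -> adj G v w -> rot G v w = a -> internal G w.
Proof.
move=> aF vw wa; apply/negP => we.
have [n1 n2] := degree_ge3 vw.
have [e|e] := external_neighbour aF (outer_next aF) vw we.
  by rewrite wa e eqxx in n1.
by rewrite wa -e eqxx in n2.
Qed.

(** The inner face shares [v] and [t] with F_0, so the edge [vt] separates the two faces. *)
Lemma external_on_inner_face v a t :
  external G v -> adj G v a -> (a, v) \notin F0 ->
  external G t -> on_face G (a, v) t -> t != v ->
  (t = a /\ (v, t) \in F0) \/ (t = rot G v a /\ (t, v) \in F0).
Proof.
move=> /externalP[a2 va2 a2F] va aF /externalP[b1 tb1 b1F].
move=> /on_faceP -/(_ _)[|b2 tb2 b2F tv]; first by rewrite /= adj_sym.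
have [] := common_vertices_two_faces tri _ va va2 tb1 tb2 b2F.
- by rewrite eq_sym.
- by rewrite (mem_face_eq _ a2F).
- apply: contra aF => f; rewrite mem_face_sym in f.
  by rewrite (mem_face_eq _ a2F) in f.
- by case=> -> e; left; split=> //; rewrite -e outer_next.
- by case=> <- ->; right.
Qed.

(** * Connectedness of the internal subgraph *)

Variable p : V -> rat.
Hypothesis p_const :
  forall x y, adj G x y -> internal G x -> internal G y -> p x = p y.

(** The differential of [q] sums to zero around each face, and only edges between an internal and an
    external vertex contribute. *)
Let q x := if internal G x then p x else 0.

Lemma sum_face_diff (f : V -> rat) C :
  \sum_(d <- face G C) (f d.2 - f d.1) = 0.
Proof. by rewrite sumrB big_face_vertex subrr. Qed.

(** The face through [w], [v] and [rot G v w] has no other external vertex than [v], so the sum for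
    [q] reduces to two terms. *)
Lemma rot_internal_const v w : external G v -> adj G v w -> internal G w ->
  internal G (rot G v w) -> p w = p (rot G v w).
Proof.
move=> ve vw wi wi'; set w' := rot G v w.
have vi : internal G v = false by rewrite /internal ve.
have wF : (w, v) \notin F0 by apply: contra wi => /outer_external[].
pose C := (w, v).
have ext t : external G t -> on_face G C t -> t = v.
  move=> te tC; apply/eqP; apply: contraT => tv.
  have [] := external_on_inner_face ve vw wF te tC tv => -[e _].
    by rewrite /internal -e te in wi.
  by rewrite /internal -e te in wi'.
have := sum_face_diff q C.
rewrite (eq_big_seq (fun d => (if d == (v, w') then p w' else 0)
                               - (if d == C then p w else 0))).
  rewrite sumrB !sum_face_delta face_id (mem_face_next G _ C) face_id.
  by move/eqP; rewrite subr_eq0 => /eqP.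
move=> [x y] /= dC; have aC : adj G C.1 C.2 by rewrite /= adj_sym.
have xy : adj G x y := adj_face dC aC.
have xC : on_face G C x by apply: (map_f (fun d => d.1) dC).
have yC : on_face G C y by apply/on_faceP => //; exists x; rewrite 1?adj_sym.
rewrite /q !xpair_eqE.
have [xv|xv] := eqVneq x v.
  have -> : y = w'.
    rewrite xv in dC; apply: (face_next_unique aC dC).
    by rewrite (mem_face_next G _ C) face_id.
  by rewrite xv vi wi' eqxx eq_sym (negbTE (adj_neq vw)).
have xi : internal G x by apply: contraT => /negbNE /ext/(_ xC) /eqP; rewrite (negbTE xv).
rewrite xi; have [yv|yv] := eqVneq y v.
  have -> : x = w by rewrite yv in dC; apply: (face_prev_unique aC dC); exact: face_id.
  by rewrite yv vi eqxx.
have yi : internal G y by apply: contraT => /negbNE /ext/(_ yC) /eqP; rewrite (negbTE yv).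
by rewrite yi andbF (p_const xy xi yi) !subrr.
Qed.

(** The same sum around the inner face across the outer edge, whose only external vertices are [u]
    and [v]. *)
Lemma outer_edge_const u v w : (u, v) \in F0 -> adj G v w -> rot G v w = u ->
  p w = p (rot G u v).
Proof.
move=> uvF vw wu; set x0 := rot G u v.
have uv := outer_adj uvF; have [ue ve] := outer_external uvF.
have ui : internal G u = false by rewrite /internal ue.
have vi : internal G v = false by rewrite /internal ve.
have wi : internal G w by apply: rot_outer_internal' uvF vw wu.
have xi : internal G x0 by apply: rot_outer_internal.
pose C := (v, u).
have aC : adj G C.1 C.2 by rewrite /= adj_sym.
have wC : (w, v) \in face G C.
  by rewrite -mem_face_next /face_next /= wu face_id.
have xC : (u, x0) \in face G C by rewrite (mem_face_next G _ C) face_id.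
(* If F_0 used both darts of the edge, [rot G v] would fix [u]. *)
have vuF : (v, u) \notin F0.
  apply/negP => vuF; have [/eqP r1 _] := degree_ge3 (outer_adj vuF).
  by apply: r1; apply: (face_next_unique (outer_dart G) (outer_next uvF) vuF).
have ext t : external G t -> on_face G C t -> t = u \/ t = v.
  move=> te tC; have [->|tu] := eqVneq t u; [by left | right].
  have [] := external_on_inner_face ue uv vuF te tC tu => -[] // e _.
  by rewrite /internal /x0 -e te in xi.
have := sum_face_diff q C.
rewrite (eq_big_seq (fun d => (if d == (u, x0) then p x0 else 0)
                               - (if d == (w, v) then p w else 0))).
  by rewrite sumrB !sum_face_delta wC xC => /eqP; rewrite subr_eq0 => /eqP.
move=> [x y] /= dC; have xy : adj G x y := adj_face dC aC.
have {}xC : on_face G C x by apply: (map_f (fun d => d.1) dC).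
have yC : on_face G C y by apply/on_faceP => //; exists x; rewrite 1?adj_sym.
have nu (d1 d2 b : V) : (b, d1) \in face G C -> (b, d2) \in face G C -> d1 = d2.
  exact: face_next_unique.
have pu (d1 d2 b : V) : (d1, b) \in face G C -> (d2, b) \in face G C -> d1 = d2.
  exact: face_prev_unique.
have vu : v != u by exact: adj_neq uv.
rewrite /q !xpair_eqE; have [xu|xu] := eqVneq x u.
  have -> : y = x0.
    by rewrite xu in dC; apply: nu dC _; rewrite (mem_face_next G _ C) face_id.
  rewrite xu ui xi eqxx /= (_ : x0 == v = false) ?andbF // .
  by apply/negbTE; apply: contraTneq xi => ->; rewrite vi.
have [xv|xv] := eqVneq x v.
  have -> : y = u by rewrite xv in dC; apply: nu dC (face_id _ _).
  by rewrite xv ui vi [u == v]eq_sym (negbTE vu) andbF.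
have xint : internal G x.
  apply: contraT => /negbNE /ext/(_ xC) [] e; first by rewrite e eqxx in xu.
  by rewrite e eqxx in xv.
have [yv|yv] := eqVneq y v.
  have -> : x = w by rewrite yv in dC; apply: pu dC wC.
  by rewrite yv vi wi eqxx.
have [yu|yu] := eqVneq y u.
  have e : x = v by rewrite yu in dC; apply: pu dC (face_id _ _).
  by rewrite e eqxx in xv.
have yint : internal G y.
  apply: contraT => /negbNE /ext/(_ yC) [] e; first by rewrite e eqxx in yu.
  by rewrite e eqxx in yv.
by rewrite xint yint andbF (p_const xy xint yint) !subrr.
Qed.

Lemma internal_neighbours_const v b x : (v, b) \in F0 -> adj G v x ->
  internal G x -> p x = p (rot G v b).
Proof.
move=> bF vx xi; have vb := outer_adj bF; have [ve be] := outer_external bF.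
have /externalP[a va aF] := ve.
have ab : rot G v a = b.
  exact: (face_next_unique (outer_dart G) (outer_next aF) bF).
have : x \in porbit (rot G v) b by rewrite (rot_cyclic vb) inE.
case/porbitP => i; rewrite permX => xE; rewrite xE in xi *; clear x vx xE.
(* Rotation starts at the external [b], where the claim is vacuous. The other external neighbour [a]
   comes last, as its successor is [b]. *)
suff [] : adj G v (iter i (rot G v) b) /\ (internal G (iter i (rot G v) b) ->
    p (iter i (rot G v) b) = p (rot G v b)) by move=> _; apply.
elim: i {xi} => [|i [va' IH]] /=; first by split; rewrite // /internal be.
split; first exact: adj_rot.
set y := iter i (rot G v) b in va' IH * => ryi.
have [yi|/negbNE ye] := boolP (internal G y).
  by rewrite -rot_internal_const // IH.
have [e|->//] := external_neighbour aF bF va' ye.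
by rewrite e ab /internal be in ryi.
Qed.

Lemma internal_const x y : internal G x -> internal G y -> p x = p y.
Proof.
(* An external vertex gets the common value of [p] at its internal neighbours; the default 0 never
   occurs, as such a vertex has a successor on F_0. *)
pose h v := if internal G v then p v else
  if [pick b | (v, b) \in F0] is Some b then p (rot G v b) else 0.
have hE v b : (v, b) \in F0 -> h v = p (rot G v b).
  move=> bF; rewrite /h /internal (outer_external bF).1 /=.
  case: pickP => [c cF|/(_ b)]; last by rewrite bF.
  by rewrite (face_next_unique (outer_dart G) bF cF).
have hi v : internal G v -> h v = p v by rewrite /h => ->.
move=> xi yi; rewrite -!hi //; apply: connect_const (adj_connected G x y).
move=> {x y xi yi} u v uv.
have mixed w z : adj G w z -> external G w -> internal G z -> h w = h z.
  move=> wz we zi; have /externalP[a wa aF] := we.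
  rewrite (hi z zi) (hE w _ (outer_next aF)); apply/esym.
  exact: internal_neighbours_const (outer_next aF) wz zi.
have outer_edge w z : (w, z) \in F0 -> h w = h z.
  move=> wzF; rewrite (hE _ _ wzF).
  have zw : adj G z w by rewrite adj_sym outer_adj.
  have [c zc cw] := rot_prev zw.
  rewrite -(outer_edge_const wzF zc cw) (hE _ _ (outer_next wzF)).
  exact: internal_neighbours_const (outer_next wzF) zc (rot_outer_internal' wzF zc cw).
have [ui|/negbNE ue] := boolP (internal G u); have [vi|/negbNE ve] := boolP (internal G v).
- by rewrite !hi ?(p_const uv).
- by apply/esym/mixed; rewrite // adj_sym.
- exact: mixed.
- by case: (outer_face_induced ue ve uv) => /outer_edge.
Qed.

End OuterFace.

(** * The two implications *)

Section Main.
Variables (V : finType) (G : plane_graph V) (tri : triconnected G).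
Local Notation fn := (face_next (Defs.rot G)).

Lemma internal_exists : exists i, internal G i.
Proof.
exists (Defs.rot G (outer G).1 (outer G).2).
by apply: rot_outer_internal => //; rewrite -surjective_pairing face_id.
Qed.

Lemma internal_connected (P : pred V) :
  (forall x y, adj G x y -> internal G x -> internal G y -> P x = P y) ->
  forall x y, internal G x -> internal G y -> P x = P y.
Proof.
move=> hP x y xi yi.
have : (P x)%:R = (P y)%:R :> rat.
  apply: (internal_const tri (p := fun v => (P v)%:R)) => // u v uv ui vi.
  by rewrite (hP u v).
by do 2!case: (P _) => //= /eqP; rewrite ?oner_eq0 // eq_sym oner_eq0.
Qed.

(** Rotating about the external vertex [v] leads from the face of [d] to F_0, and no edge at [v] is
    internal. This is the last hypothesis of [closed_exact]. *)
Lemma external_faces_connected (U : Type) (f : V * V -> U) :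
  (forall d, f (fn d) = f d) ->
  (forall d, adj G d.1 d.2 -> ~~ (internal G d.1 && internal G d.2) ->
     f d = f (d.2, d.1)) ->
  forall d v, adj G d.1 d.2 -> on_face G d v -> ~~ internal G v ->
    f d = f (outer G).
Proof.
move=> fF fo d v ad vd vext.
have /negbNE /externalP[a va aF] := vext.
have /(on_faceP _ ad)[b vb bd] := vd.
rewrite -(face_const fF aF) -(face_const fF bd).
apply: (face_fun_const (G := G)) => // w vw.
by apply: (fo (v, w)) => //=; rewrite (negbTE vext).
Qed.

End Main.

Theorem theorem2 (R : realType) (V : finType) (G : plane_graph V)
    (gamma : V -> 'rV[R]_2) (z : V -> V -> R)
    (tri : triconnected G)
    (drawing : straight_line_planar_drawing G gamma)
    (convex : outer_face_convex G gamma)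
    (z_gt0 : forall i j, internal G i -> adj G i j -> 0 < z i j)
    (z_sum : forall i, internal G i -> \sum_(j | adj G i j) z i j = 1)
    (z_bary : forall i, internal G i ->
       gamma i = \sum_(j | adj G i j) z i j *: gamma j) :
  (exists s : V -> R,
     (exists2 i, internal G i & s i != 0) /\
     (forall i j, strictly_internal_edge G i j ->
        s i * z i j - s j * z j i = 0))
  <->
  (forall C, strictly_internal_face G C ->
     \prod_(d <- face G C) z d.1 d.2 = \prod_(d <- face G C) z d.2 d.1).
Proof.
have z_neq0 i j : adj G i j -> internal G i -> z i j != 0.
  by move=> ij ii; rewrite gt_eqF // z_gt0.
have face_edge C d : strictly_internal_face G C -> d \in face G C ->
    [/\ adj G d.1 d.2, internal G d.1 & internal G d.2].
  move=> [aC iC] dC; have ad := adj_face dC aC; split=> //; apply: iC.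
    exact: (map_f (fun d => d.1)).
  have : (face_next (Defs.rot G) d) \in face G C by rewrite mem_face_next.
  exact: (map_f (fun d => d.1)).
split=> [[s [[i0 i0i si0] sz]] C intC|faces].
  (* As the [z] are nonzero, [s] vanishes at both ends of a strictly internal edge or at neither;
     connectedness spreads this from [i0]. *)
  have s_neq0 i : internal G i -> s i != 0.
    move=> ii; rewrite (_ : (s i != 0) = (s i0 != 0)) //.
    apply: (internal_connected tri (P := fun i => s i != 0)) => // x y xy xi yi.
    have /sz/eqP : strictly_internal_edge G x y by apply/and3P.
    rewrite subr_eq0 => /eqP e.
    have := mulf_eq0 (s x) (z x y); rewrite e mulf_eq0.
    rewrite (negbTE (z_neq0 x y xy xi)) (negbTE (z_neq0 y x _ yi)) 1?adj_sym //.
    by rewrite !orbF => ->.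
  have sface : \prod_(d <- face G C) s d.1 != 0.
    rewrite prodf_seq_neq0; apply/allP => d dC /=.
    by have [_ di _] := face_edge C d intC dC; apply: s_neq0.
  (* The product of [s] over the tails of the face equals that over the heads, so the edge equations
     can be multiplied together. *)
  apply: (mulfI sface); rewrite -{2}big_face_vertex -!big_split /=.
  apply: eq_big_seq => d /(face_edge C d intC)[ad d1 d2].
  by apply/eqP; rewrite -subr_eq0 sz //; apply/and3P.
(* The product condition on a face says that [c] sums to zero around it. *)
pose c i j := ln (z i j) - ln (z j i).
have [] := @closed_exact V G R (internal G) c.
- by move=> x y; rewrite /c opprB.
- move=> C aC iC; have intC : strictly_internal_face G C by [].
  rewrite sumrB; apply/eqP; rewrite subr_eq0; apply/eqP; apply: expR_inj.
  rewrite !expR_sum; transitivity (\prod_(d <- face G C) z d.1 d.2).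
    apply: eq_big_seq => d /(face_edge C d intC)[ad d1 d2].
    by rewrite lnK // posrE z_gt0.
  rewrite faces //; apply: eq_big_seq => d /(face_edge C d intC)[ad d1 d2].
  by rewrite lnK // posrE z_gt0 // adj_sym.
- move=> f fF fo; exists (f (outer G)) => d v ad vd vext.
  exact: (external_faces_connected fF fo ad vd vext).
move=> p cp; exists (fun i => expR (p i)); split.
  have [i ii] := internal_exists tri.
  by exists i => //; rewrite gt_eqF // expR_gt0.
move=> i j /and3P[ij ii ji].
have ji_adj : adj G j i by rewrite adj_sym.
rewrite -{1}(lnK (z_gt0 i j ii ij)) -{1}(lnK (z_gt0 j i ji ji_adj)) -!expRD.
have := cp i j ij ii ji; rewrite /c => /(congr1 (+%R^~ (p i + ln (z j i)))).
rewrite subrKA addrC => e.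
by apply/eqP; rewrite subr_eq0; apply/eqP; congr expR; lra.
Qed.
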